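(* Let $(\mathfrak{g},[\cdot,\cdot]_\mathfrak{g},N)$ be a Nijenhuis Lie algebra and let $S:\mathfrak{g}\to\mathfrak{g}$ be a linear map admissible to $(\mathfrak{g},[\cdot,\cdot]_\mathfrak{g},N)$. Let $r\in\mathfrak{g}\otimes\mathfrak{g}$ be an antisymmetric solution of the admissible classical Yang-Baxter equation in $(\mathfrak{g},[\cdot,\cdot]_\mathfrak{g},N)$ for the admissible map $S$. Then $(\mathfrak{g},[\cdot,\cdot]_\mathfrak{g},N,\delta,S)$ is a Nijenhuis Lie bialgebra, where $\delta:\mathfrak{g}\to\mathfrak{g}\otimes\mathfrak{g}$ is given by $\delta(x)=\big((\mathrm{ad}_\mathfrak{g})_x\otimes\mathrm{Id}_\mathfrak{g}+\mathrm{Id}_\mathfrak{g}\otimes(\mathrm{ad}_\mathfrak{g})_x\big)r$ for all $x\in\mathfrak{g}$.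
   Context: A Nijenhuis Lie algebra $(\mathfrak{g},[\cdot,\cdot]_\mathfrak{g},N)$ is a Lie algebra with a linear map $N$ satisfying $[Nx,Ny]_\mathfrak{g}=N([Nx,y]_\mathfrak{g}+[x,Ny]_\mathfrak{g}-N[x,y]_\mathfrak{g})$. A linear map $S:\mathfrak{g}\to\mathfrak{g}$ is admissible to it if $S[Nx,y]_\mathfrak{g}+[x,S^2y]_\mathfrak{g}=[Nx,Sy]_\mathfrak{g}+S[x,Sy]_\mathfrak{g}$ for all $x,y\in\mathfrak{g}$. A Lie coalgebra $(\mathfrak{g},\delta)$: $\delta:\mathfrak{g}\to\mathfrak{g}\otimes\mathfrak{g}$ linear with $\delta=-\tau\delta$ ($\tau$ the flip) and $(\mathrm{Id}+\sigma+\sigma^2)(\mathrm{Id}\otimes\delta)\delta=0$, $\sigma(x\otimes y\otimes z)=y\otimes z\otimes x$. A Nijenhuis Lie coalgebra $(\mathfrak{g},\delta,S)$ is a Lie coalgebra with linear $S$ satisfying $(S\otimes S)\delta(x)=(S\otimes\mathrm{Id}+\mathrm{Id}\otimes S)\delta(S(x))-\delta(S^2(x))$. A Nijenhuis Lie bialgebra $(\mathfrak{g},[\cdot,\cdot]_\mathfrak{g},N,\delta,S)$ consists of a Nijenhuis Lie algebra $(\mathfrak{g},[\cdot,\cdot]_\mathfrak{g},N)$ and a Nijenhuis Lie coalgebra $(\mathfrak{g},\delta,S)$ such that: (a) $\delta([x,y]_\mathfrak{g})=(\mathrm{ad}_x\otimes\mathrm{Id}+\mathrm{Id}\otimes\mathrm{ad}_x)\delta(y)-(\mathrm{ad}_y\otimes\mathrm{Id}+\mathrm{Id}\otimes\mathrm{ad}_y)\delta(x)$;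 (b) $S$ is admissible to $(\mathfrak{g},[\cdot,\cdot]_\mathfrak{g},N)$; (c) $(N\otimes S)\delta(x)+(N\otimes\mathrm{Id}-\mathrm{Id}\otimes S)\delta(N(x))-(N^2\otimes\mathrm{Id})\delta(x)=0$ (all $x,y\in\mathfrak{g}$). For $r=\sum_ip_i\otimes q_i\in\mathfrak{g}\otimes\mathfrak{g}$, the admissible classical Yang-Baxter equation (in $(\mathfrak{g},[\cdot,\cdot]_\mathfrak{g},N)$ and for the admissible map $S$) is the system $$\sum_{i,j}\big([p_i,p_j]_\mathfrak{g}\otimes q_i\otimes q_j+p_i\otimes[q_i,p_j]_\mathfrak{g}\otimes q_j+p_i\otimes p_j\otimes[q_i,q_j]_\mathfrak{g}\big)=0,$$ $$(N\otimes\mathrm{Id}_\mathfrak{g}-\mathrm{Id}_\mathfrak{g}\otimes S)(r)=0,\qquad(S\otimes\mathrm{Id}_\mathfrak{g}-\mathrm{Id}_\mathfrak{g}\otimes N)(r)=0.$$ Antisymmetric means $\tau(r)=-r$. *)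

(* Defs.v *)
From HB Require Import structures.
From mathcomp Require Import all_boot all_order all_algebra.
From mathcomp Require Import boolp.

Set Implicit Arguments.
Unset Strict Implicit.
Unset Printing Implicit Defensive.

Import GRing.Theory.
Local Open Scope ring_scope.

(* [tensor U V] is the quotient of the formal sums of pairs (lists over
   U * V, with concatenation as addition) by the congruence generated by
   commutativity of the sum and bilinearity of the pairing.  The opposite
   and the scaling of a formal sum act on first components. *)
Section Tensor.
Variables (K : fieldType) (U V : lmodType K).
Implicit Types s t : seq (U * V).

Inductive tensor_eq : seq (U * V) -> seq (U * V) -> Prop :=
| tensor_eq_refl s : tensor_eq s s
| tensor_eq_sym s t : tensor_eq s t -> tensor_eq t s
| tensor_eq_trans s t u : tensor_eq s t -> tensor_eq t u -> tensor_eq s u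
| tensor_eq_cat s s' t t' :
    tensor_eq s s' -> tensor_eq t t' -> tensor_eq (s ++ t) (s' ++ t')
| tensor_eq_catC s t : tensor_eq (s ++ t) (t ++ s)
| tensor_eq_0l y : tensor_eq [:: (0, y)] [::]
| tensor_eq_Dl x x' y : tensor_eq [:: (x + x', y)] [:: (x, y); (x', y)]
| tensor_eq_Dr x y y' : tensor_eq [:: (x, y + y')] [:: (x, y); (x, y')]
| tensor_eq_Z a x y : tensor_eq [:: (a *: x, y)] [:: (x, a *: y)].

Definition tensor_eqb : rel (seq (U * V)) := fun s t => `[< tensor_eq s t >].

Lemma tensor_eqb_equiv : equiv_class_of tensor_eqb.
Proof.
split.
- by move=> s; apply/asboolP; exact: tensor_eq_refl.
- by move=> s t; apply/asboolP/asboolP; exact: tensor_eq_sym.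
- move=> t s u /asboolP st /asboolP tu; apply/asboolP.
  exact: tensor_eq_trans st tu.
Qed.

Canonical tensor_equiv := EquivRelPack tensor_eqb_equiv.

Definition tensor : Type := {eq_quot tensor_equiv}%qT.
HB.instance Definition _ := Choice.on tensor.
HB.instance Definition _ := Quotient.on tensor.
HB.instance Definition _ := EqQuotient.on tensor.

Definition tensor_class s : tensor := (\pi_tensor s)%qT.
Definition tensor_terms (t : tensor) : seq (U * V) := repr t.

Lemma tensor_termsK (t : tensor) : tensor_class (tensor_terms t) = t.
Proof. exact: reprK. Qed.

Lemma tensor_classP s t : tensor_class s = tensor_class t <-> tensor_eq s t.
Proof.
split; first by move/eqquotP/asboolP.
by move=> st; apply/eqquotP/asboolP.
Qed.

Lemma tensor_terms_class s : tensor_eq (tensor_terms (tensor_class s)) s.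
Proof. by apply/tensor_classP; rewrite tensor_termsK. Qed.

Definition scale_terms (a : K) s := [seq (a *: p.1, p.2) | p <- s].

Lemma scale_terms_eq a s t :
  tensor_eq s t -> tensor_eq (scale_terms a s) (scale_terms a t).
Proof.
rewrite /scale_terms; elim=> {s t} /=.
- by move=> s; exact: tensor_eq_refl.
- by move=> s t _; exact: tensor_eq_sym.
- by move=> s t u _ st _ tu; exact: tensor_eq_trans st tu.
- by move=> s s' t t' _ ss' _ tt'; rewrite !map_cat; exact: tensor_eq_cat.
- by move=> s t; rewrite !map_cat; exact: tensor_eq_catC.
- by move=> y; rewrite scaler0; exact: tensor_eq_0l.
- by move=> x x' y; rewrite scalerDr; exact: tensor_eq_Dl.
- by move=> x y y'; exact: tensor_eq_Dr.
- by move=> b x y; rewrite scalerA mulrC -scalerA; exact: tensor_eq_Z.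
Qed.

Definition tensor_zero : tensor := tensor_class [::].
Definition tensor_add (t u : tensor) : tensor :=
  tensor_class (tensor_terms t ++ tensor_terms u).
Definition tensor_scale (a : K) (t : tensor) : tensor :=
  tensor_class (scale_terms a (tensor_terms t)).
Definition tensor_opp (t : tensor) : tensor := tensor_scale (-1) t.

Lemma tensor_add_class s t :
  tensor_add (tensor_class s) (tensor_class t) = tensor_class (s ++ t).
Proof. by apply/tensor_classP/tensor_eq_cat; exact: tensor_terms_class. Qed.

Lemma tensor_scale_class a s :
  tensor_scale a (tensor_class s) = tensor_class (scale_terms a s).
Proof. by apply/tensor_classP/scale_terms_eq; exact: tensor_terms_class. Qed.

Lemma tensor_addA : associative tensor_add.
Proof.
move=> t u v.
rewrite -(tensor_termsK t) -(tensor_termsK u) -(tensor_termsK v).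
by rewrite !tensor_add_class catA.
Qed.

Lemma tensor_addC : commutative tensor_add.
Proof. by move=> t u; apply/tensor_classP; exact: tensor_eq_catC. Qed.

Lemma tensor_add0 : left_id tensor_zero tensor_add.
Proof.
by move=> t; rewrite -(tensor_termsK t) tensor_add_class.
Qed.

Lemma scale_termsD a b s :
  tensor_eq (scale_terms (a + b) s) (scale_terms a s ++ scale_terms b s).
Proof.
elim: s => [|[x y] s IHs]; first exact: tensor_eq_refl.
rewrite /= -cat1s scalerDl.
apply: tensor_eq_trans (tensor_eq_cat (tensor_eq_Dl _ _ _) IHs) _.
rewrite /= -[(b *: x, y) :: _]cat1s -[(a *: x, y) :: _]cat1s.
rewrite -[_ :: scale_terms a s ++ _]cat1s.
apply: tensor_eq_cat; first exact: tensor_eq_refl.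
rewrite -[(b *: x, y) :: scale_terms b s]cat1s !catA.
by apply: tensor_eq_cat; [exact: tensor_eq_catC | exact: tensor_eq_refl].
Qed.

Lemma scale_terms0 s : tensor_eq (scale_terms 0 s) [::].
Proof.
elim: s => [|[x y] s IHs]; first exact: tensor_eq_refl.
rewrite /= scale0r -cat1s.
exact: tensor_eq_cat (tensor_eq_0l y) IHs.
Qed.

Lemma scale_terms1 s : scale_terms 1 s = s.
Proof. by elim: s => //= -[x y] s ->; rewrite scale1r. Qed.

Lemma tensor_addN : left_inverse tensor_zero tensor_opp tensor_add.
Proof.
move=> t; rewrite -(tensor_termsK t) /tensor_opp tensor_scale_class.
rewrite tensor_add_class; apply/tensor_classP.
rewrite -[X in _ ++ X]scale_terms1.
apply: tensor_eq_trans (tensor_eq_sym (scale_termsD _ _ _)) _.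
by rewrite addNr; exact: scale_terms0.
Qed.

HB.instance Definition _ := GRing.isZmodule.Build tensor
  tensor_addA tensor_addC tensor_add0 tensor_addN.

Lemma tensor_classD s t :
  tensor_class s + tensor_class t = tensor_class (s ++ t).
Proof. exact: tensor_add_class. Qed.

Lemma tensor_scaleA a b (t : tensor) :
  tensor_scale a (tensor_scale b t) = tensor_scale (a * b) t.
Proof.
rewrite -(tensor_termsK t) !tensor_scale_class /scale_terms -map_comp.
by congr tensor_class; apply: eq_map => p /=; rewrite scalerA.
Qed.

Lemma tensor_scale1 : left_id 1 tensor_scale.
Proof.
by move=> t; rewrite -(tensor_termsK t) tensor_scale_class scale_terms1.
Qed.

Lemma tensor_scaleDr : right_distributive tensor_scale +%R.
Proof.
move=> a t u; rewrite -(tensor_termsK t) -(tensor_termsK u).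
rewrite tensor_classD !tensor_scale_class tensor_classD.
by rewrite /scale_terms map_cat.
Qed.

Lemma tensor_scaleDl (t : tensor) : {morph tensor_scale^~ t : a b / a + b}.
Proof.
move=> a b; rewrite -(tensor_termsK t) !tensor_scale_class.
rewrite tensor_classD; apply/tensor_classP; exact: scale_termsD.
Qed.

HB.instance Definition _ := GRing.Zmodule_isLmodule.Build K tensor
  tensor_scaleA tensor_scale1 tensor_scaleDr tensor_scaleDl.

Lemma tensor_classZ a s : a *: tensor_class s = tensor_class (scale_terms a s).
Proof. exact: tensor_scale_class. Qed.

Definition tens (x : U) (y : V) : tensor := tensor_class [:: (x, y)].

Lemma tens_bilinear : bilinear_for *:%R *:%R tens.
Proof.
split=> [y a x x'|x a y y'].
  rewrite /tens /= tensor_classZ tensor_classD.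
  by apply/tensor_classP; exact: tensor_eq_Dl.
rewrite /tens /= tensor_classZ tensor_classD.
apply/tensor_classP; apply: tensor_eq_trans (tensor_eq_Dr _ _ _) _.
apply: (@tensor_eq_cat [:: _] [:: _] [:: _] [:: _]).
  exact/tensor_eq_sym/tensor_eq_Z.
exact: tensor_eq_refl.
Qed.

Lemma tensor_class_sum s : tensor_class s = \sum_(p <- s) tens p.1 p.2.
Proof.
elim: s => [|[x y] s IHs]; first by rewrite big_nil.
by rewrite big_cons /= -IHs tensor_classD.
Qed.

Lemma tensor_sum (t : tensor) : t = \sum_(p <- tensor_terms t) tens p.1 p.2.
Proof. by rewrite -tensor_class_sum tensor_termsK. Qed.

End Tensor.

Notation "x \ox y" := (tens x y) (at level 40, left associativity) : ring_scope.

(* The map on the tensor product induced by a bilinear map f (it is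
   meaningful only for such f). *)
Definition tensor_lift (K : fieldType) (U V W : lmodType K) (f : U -> V -> W)
  (t : tensor U V) : W := \sum_(p <- tensor_terms t) f p.1 p.2.

Section UniversalProperty.
Variables (K : fieldType) (U V W : lmodType K) (f : U -> V -> W).
Hypothesis f_bilin : bilinear_for *:%R *:%R f.

Lemma tensor_eq_lift s t : tensor_eq s t ->
  \sum_(p <- s) f p.1 p.2 = \sum_(p <- t) f p.1 p.2.
Proof.
have fDl x x' y : f (x + x') y = f x y + f x' y.
  by have := f_bilin.1 y 1 x x'; rewrite /= !scale1r.
have fDr x y y' : f x (y + y') = f x y + f x y'.
  by have := f_bilin.2 x 1 y y'; rewrite /= !scale1r.
have f0l y : f 0 y = 0.
  by apply: (addrI (f 0 y)); rewrite -fDl !addr0.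
have f0r x : f x 0 = 0.
  by apply: (addrI (f x 0)); rewrite -fDr !addr0.
elim=> {s t} //=.
- by move=> s t u _ -> _ ->.
- by move=> s s' t t' _ ss' _ tt'; rewrite !big_cat /= ss' tt'.
- by move=> s t; rewrite !big_cat /= addrC.
- by move=> y; rewrite big_cons !big_nil /= f0l addr0.
- by move=> x x' y; rewrite !big_cons !big_nil /= fDl addrA.
- by move=> x y y'; rewrite !big_cons !big_nil /= fDr addrA.
- move=> a x y; rewrite !big_cons !big_nil /= !addr0.
  have := f_bilin.1 y a x 0; have := f_bilin.2 x a y 0.
  by rewrite f0l f0r !addr0 => -> ->.
Qed.

Lemma tensor_lift_class s :
  tensor_lift f (tensor_class s) = \sum_(p <- s) f p.1 p.2.
Proof. exact/tensor_eq_lift/tensor_terms_class. Qed.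

Lemma tensor_lift_tens x y : tensor_lift f (x \ox y) = f x y.
Proof. by rewrite tensor_lift_class big_seq1. Qed.

Lemma tensor_lift_linear : linear (tensor_lift f).
Proof.
move=> a t u; rewrite -(tensor_termsK t) -(tensor_termsK u).
rewrite tensor_classZ tensor_classD.
rewrite !tensor_lift_class big_cat big_map /= scaler_sumr; congr (_ + _).
apply: eq_bigr => p _.
have f0l : f 0 p.2 = 0.
  apply: (addrI (f 0 p.2)).
  by have := f_bilin.1 p.2 1 0 0; rewrite /= !scale1r !addr0 => <-.
by have := f_bilin.1 p.2 a p.1 0; rewrite f0l !addr0.
Qed.

Lemma tensor_lift_unique (h : {linear tensor U V -> W}) :
  (forall x y, h (x \ox y) = f x y) -> h =1 tensor_lift f.
Proof.
move=> hf t; rewrite [in LHS](tensor_sum t) linear_sum.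
by apply: eq_bigr => p _; exact: hf.
Qed.

End UniversalProperty.

Section TensorMaps.
Variable K : fieldType.

Definition tensor_map (U U' V V' : lmodType K)
    (f : {linear U -> U'}) (h : {linear V -> V'}) :
    tensor U V -> tensor U' V' :=
  tensor_lift (fun x y => f x \ox h y).

Definition tensor_flip (U V : lmodType K) : tensor U V -> tensor V U :=
  tensor_lift (fun x y => y \ox x).

(* The triple tensor product is right-nested; this is
   x \ox (y \ox z) |-> y \ox (z \ox x). *)
Definition tensor_cycle (U V W : lmodType K) :
    tensor U (tensor V W) -> tensor V (tensor W U) :=
  tensor_lift (fun x => tensor_lift (fun y z => y \ox (z \ox x))).

Lemma tensor_map_bilinear (U U' V V' : lmodType K)
    (f : {linear U -> U'}) (h : {linear V -> V'}) :
  bilinear_for *:%R *:%R (fun x y => f x \ox h y).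
Proof.
split=> [y a x x'|x a y y'] /=.
  by rewrite linearP (tens_bilinear U' V').1.
by rewrite linearP (tens_bilinear U' V').2.
Qed.

Lemma tensor_flip_bilinear (U V : lmodType K) :
  bilinear_for *:%R *:%R (fun (x : U) (y : V) => y \ox x).
Proof.
by split=> [y|x]; [exact: (tens_bilinear V U).2 | exact: (tens_bilinear V U).1].
Qed.

Lemma tensor_cycle_bilinear2 (U V W : lmodType K) (x : U) :
  bilinear_for *:%R *:%R (fun (y : V) (z : W) => y \ox (z \ox x)).
Proof.
split=> [z|y a z z'] /=; first exact: (tens_bilinear _ _).1.
by rewrite (tens_bilinear W U).1 (tens_bilinear _ _).2.
Qed.

Lemma tensor_cycle_bilinear (U V W : lmodType K) :
  bilinear_for *:%R *:%R (fun (x : U) (t : tensor V W) =>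
    tensor_lift (fun y z => y \ox (z \ox x)) t).
Proof.
split=> [t a x x'|x] /=; last exact/tensor_lift_linear/tensor_cycle_bilinear2.
rewrite /tensor_lift scaler_sumr -big_split; apply: eq_bigr => p _ /=.
by rewrite (tens_bilinear W U).2 (tens_bilinear _ _).2.
Qed.

Lemma tensor_mapE (U U' V V' : lmodType K)
    (f : {linear U -> U'}) (h : {linear V -> V'}) x y :
  tensor_map f h (x \ox y) = f x \ox h y.
Proof. exact/tensor_lift_tens/tensor_map_bilinear. Qed.

Lemma tensor_flipE (U V : lmodType K) (x : U) (y : V) :
  tensor_flip (x \ox y) = y \ox x.
Proof. exact/tensor_lift_tens/tensor_flip_bilinear. Qed.

Lemma tensor_cycleE (U V W : lmodType K) (x : U) (y : V) (z : W) :
  tensor_cycle (x \ox (y \ox z)) = y \ox (z \ox x).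
Proof.
rewrite /tensor_cycle (tensor_lift_tens (tensor_cycle_bilinear _ _ _)).
exact/tensor_lift_tens/tensor_cycle_bilinear2.
Qed.

HB.instance Definition _ (U U' V V' : lmodType K)
    (f : {linear U -> U'}) (h : {linear V -> V'}) :=
  GRing.isLinear.Build K (tensor U V) (tensor U' V') *:%R (tensor_map f h)
    (tensor_lift_linear (tensor_map_bilinear f h)).

HB.instance Definition _ (U V : lmodType K) :=
  GRing.isLinear.Build K (tensor U V) (tensor V U) *:%R (@tensor_flip U V)
    (tensor_lift_linear (tensor_flip_bilinear U V)).

HB.instance Definition _ (U V W : lmodType K) :=
  GRing.isLinear.Build K (tensor U (tensor V W)) (tensor V (tensor W U)) *:%R
    (@tensor_cycle U V W)
    (tensor_lift_linear (tensor_cycle_bilinear U V W)).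

End TensorMaps.

Section NijenhuisLieCoalgebra.
Variables (K : fieldType) (C : lmodType K).
Implicit Types d : {linear C -> tensor C C}.

Definition lie_coalgebra d :=
  (forall x, d x = - tensor_flip (d x)) /\
  (forall x, let t := tensor_map idfun d (d x) in
     t + tensor_cycle t + tensor_cycle (tensor_cycle t) = 0).

Definition nijenhuis_lie_coalgebra d (S : {linear C -> C}) :=
  lie_coalgebra d /\
  (forall x, tensor_map S S (d x) =
     tensor_map S idfun (d (S x)) + tensor_map idfun S (d (S x)) - d (S (S x))).

End NijenhuisLieCoalgebra.

HB.mixin Record isLieAlgebra (K : fieldType) g of GRing.Lmodule K g := {
  lie_bracket : g -> g -> g;
  lie_bracketl_linear : forall y, linear (lie_bracket^~ y);
  lie_bracketr_linear : forall x, linear (lie_bracket x);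
  lie_bracketxx : forall x, lie_bracket x x = 0;
  lie_jacobi : forall x y z,
    lie_bracket x (lie_bracket y z) + lie_bracket y (lie_bracket z x)
      + lie_bracket z (lie_bracket x y) = 0
}.

#[short(type="lieAlgType")]
HB.structure Definition LieAlgebra (K : fieldType) :=
  {g of isLieAlgebra K g & GRing.Lmodule K g}.

Notation "[ 'lie' x , y ]" := (lie_bracket x y)
  (at level 0, x at level 99, y at level 99,
   format "[ 'lie'  x ,  y ]") : ring_scope.

Section NijenhuisLieBialgebra.
Variables (K : fieldType) (g : lieAlgType K).
Implicit Types (x y : g) (N S : {linear g -> g}) (r : tensor g g).

Definition ad x : g -> g := lie_bracket x.

HB.instance Definition _ x :=
  GRing.isLinear.Build K g g *:%R (ad x) (lie_bracketr_linear x).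

Definition nijenhuis_lie_algebra N :=
  forall x y, [lie N x, N y] = N ([lie N x, y] + [lie x, N y] - N [lie x, y]).

Definition admissible N S :=
  forall x y, S [lie N x, y] + [lie x, S (S y)] =
    [lie N x, S y] + S [lie x, S y].

Definition nijenhuis_lie_bialgebra N (d : {linear g -> tensor g g}) S :=
  [/\ nijenhuis_lie_algebra N /\ nijenhuis_lie_coalgebra d S,
      forall x y, d [lie x, y] =
        (tensor_map (ad x) idfun (d y) + tensor_map idfun (ad x) (d y))
        - (tensor_map (ad y) idfun (d x) + tensor_map idfun (ad y) (d x)),
      admissible N S
    & forall x, tensor_map N S (d x)
        + (tensor_map N idfun (d (N x)) - tensor_map idfun S (d (N x)))
        - tensor_map (N \o N) idfun (d x) = 0].

(* Computed on the chosen expansion of r as a sum of pure tensors;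
   [yang_baxterE] shows that any other expansion gives the same value. *)
Definition yang_baxter r : tensor g (tensor g g) :=
  \sum_(u <- tensor_terms r) \sum_(v <- tensor_terms r)
    ([lie u.1, v.1] \ox (u.2 \ox v.2) + u.1 \ox ([lie u.2, v.1] \ox v.2)
     + u.1 \ox (v.1 \ox [lie u.2, v.2])).

Lemma yang_baxterE r (s : seq (g * g)) : r = \sum_(p <- s) p.1 \ox p.2 ->
  yang_baxter r = \sum_(u <- s) \sum_(v <- s)
    ([lie u.1, v.1] \ox (u.2 \ox v.2) + u.1 \ox ([lie u.2, v.1] \ox v.2)
     + u.1 \ox (v.1 \ox [lie u.2, v.2])).
Proof.
rewrite -tensor_class_sum => rE.
have rs : tensor_eq (tensor_terms r) s.
  by rewrite rE; exact: tensor_terms_class.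
have B (V W : lmodType K) := tens_bilinear V W.
pose F (p q p' q' : g) := [lie p, p'] \ox (q \ox q')
  + p \ox ([lie q, p'] \ox q') + p \ox (p' \ox [lie q, q']).
have F2 p q : bilinear_for *:%R *:%R (F p q).
  split=> [y a x x'|x a y y']; rewrite /F /=.
    rewrite !(lie_bracketr_linear, (B _ _).1, (B _ _).2) !scalerDr.
    by rewrite [X in X + _ = _]addrACA [LHS]addrACA.
  rewrite !(lie_bracketr_linear, (B _ _).1, (B _ _).2) !scalerDr.
  by rewrite [X in X + _ = _]addrACA [LHS]addrACA.
have F1 : bilinear_for *:%R *:%R
    (fun p q => \sum_(v <- s) F p q v.1 v.2).
  split=> [y a x x'|x a y y'];
    rewrite /= scaler_sumr -big_split; apply: eq_bigr => v _; rewrite /F /=.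
    rewrite !(lie_bracketl_linear, (B _ _).1, (B _ _).2) !scalerDr.
    by rewrite [X in X + _ = _]addrACA [LHS]addrACA.
  rewrite !(lie_bracketl_linear, (B _ _).1, (B _ _).2) !scalerDr.
  by rewrite [X in X + _ = _]addrACA [LHS]addrACA.
rewrite -(tensor_eq_lift F1 rs); apply: eq_bigr => u _.
exact: (tensor_eq_lift (F2 u.1 u.2) rs).
Qed.

Definition admissible_yang_baxter N S r :=
  [/\ yang_baxter r = 0,
      tensor_map N idfun r - tensor_map idfun S r = 0
    & tensor_map S idfun r - tensor_map idfun N r = 0].

Definition antisymmetric_tensor r := tensor_flip r = - r.

Definition coboundary r x : tensor g g :=
  tensor_map (ad x) idfun r + tensor_map idfun (ad x) r.

Lemma coboundary_linear r : linear (coboundary r).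
Proof.
have adD a x y z : ad (a *: x + y) z = a *: ad x z + ad y z.
  exact: lie_bracketl_linear.
have B (V W : lmodType K) := tens_bilinear V W.
move=> a x y; rewrite /coboundary scalerDr addrACA.
rewrite /tensor_map /tensor_lift !scaler_sumr -!big_split /=.
by apply: eq_bigr => p _; rewrite !adD (B _ _).1 (B _ _).2.
Qed.

HB.instance Definition _ r :=
  GRing.isLinear.Build K g (tensor g g) *:%R (coboundary r)
    (coboundary_linear r).

End NijenhuisLieBialgebra.

(* Main.v *)
Require Import Defs.
From HB Require Import structures.
From mathcomp Require Import all_boot all_order all_algebra.

(** Write [x._i] for [ad x] acting on the i-th factor of a threefold tensor and
    [sigma] for the cyclic rotation of the factors.

    The coboundary [delta x = (x._1 + x._2) r] is a 1-cocycle because [ad] is a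
    representation, and it is antisymmetric because [r] is.

    The co-Jacobi identity comes from the Yang-Baxter equation.  Put
    [c = [r13, r23]].  Antisymmetry of [r] gives [[r12, r23] = sigma c] and
    [[r12, r13] = sigma^2 c], so the Yang-Baxter element is the cyclic sum of
    [c] ([yang_baxter_cyclic]).  On the other hand, expanding both coboundaries
    shows that, up to a term [t - sigma^2 t] of zero cyclic sum,
    [(Id \ox delta) (delta x)] equals [x._1 c + x._1 (sigma c) + x._3 c]
    ([tensor_map_coboundary], [tensor_map_coboundary_ad]).  Since
    [x._1 sigma = sigma x._2], its cyclic sum is that of
    [(x._1 + x._2 + x._3) c].  As [x._1 + x._2 + x._3] commutes with [sigma],
    this is [x._1 + x._2 + x._3] applied to the Yang-Baxter element, hence zero.
    The argument never divides, so it holds in every characteristic.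

    The two identities involving [N] and [S] split by factors.  The linear
    conditions on [r] move an [N] or [S] acting on one factor of [r] to the
    other factor ([tensor_map_slide]), which turns every term into
    [(f \ox Id) r] or [(Id \ox h) r].  The terms [f] then match by one
    four-term identity and the terms [h] by another, each of them being either
    the Nijenhuis identity of [N] or the admissibility of [S]. *)

Set Implicit Arguments.
Unset Strict Implicit.
Unset Printing Implicit Defensive.

Import GRing.Theory.
Local Open Scope ring_scope.

(** * Tensor products of linear maps *)

HB.instance Definition _ (K : fieldType) (U V : lmodType K) :=
  bilinear_isBilinear.Build K U V (tensor U V) *:%R *:%R (@tens K U V)
    (tens_bilinear U V).

HB.instance Definition _ (K : fieldType) (U V : lmodType K) (x : U) :=
  GRing.isLinear.Build K V (tensor U V) *:%R (tens x) ((tens_bilinear U V).2 x).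

Section TensorMapTheory.
Variable K : fieldType.
Implicit Types U V W : lmodType K.

Lemma tensor_ext U V W (f h : {linear tensor U V -> W}) :
  (forall x y, f (x \ox y) = h (x \ox y)) -> f =1 h.
Proof.
move=> fh t; rewrite (tensor_sum t) !linear_sum.
by apply: eq_bigr => p _; apply: fh.
Qed.

Lemma tensor3_ext U V W (X : lmodType K)
    (f h : {linear tensor U (tensor V W) -> X}) :
  (forall x y z, f (x \ox (y \ox z)) = h (x \ox (y \ox z))) -> f =1 h.
Proof.
move=> fh; apply: tensor_ext => x.
have /= := @tensor_ext _ _ _ (f \o tens x) (h \o tens x) (fh x).
by move=> H t; apply: H.
Qed.

Lemma tensor_map_comp U U' U'' V V' V'' (f : {linear U -> U'})
    (f' : {linear U' -> U''}) (h : {linear V -> V'}) (h' : {linear V' -> V''})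
    (t : tensor U V) :
  tensor_map f' h' (tensor_map f h t) = tensor_map (f' \o f) (h' \o h) t.
Proof.
apply: (tensor_ext (f := tensor_map f' h' \o tensor_map f h)) => x y.
by rewrite /= !tensor_mapE.
Qed.

Lemma tensor_map_id U V (t : tensor U V) : tensor_map idfun idfun t = t.
Proof. by apply: (tensor_ext (h := idfun)) => x y; rewrite /= tensor_mapE. Qed.

Lemma eq_tensor_map U U' V V' (f f' : {linear U -> U'})
    (h h' : {linear V -> V'}) :
  f =1 f' -> h =1 h' -> tensor_map f h =1 tensor_map f' h'.
Proof.
move=> ff' hh' t; rewrite /tensor_map /tensor_lift.
by apply: eq_bigr => p _; rewrite ff' hh'.
Qed.

Lemma tensor_mapDl U U' V V' (f f' : {linear U -> U'}) (h : {linear V -> V'})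
    (t : tensor U V) :
  tensor_map (f \+ f') h t = tensor_map f h t + tensor_map f' h t.
Proof.
rewrite /tensor_map /tensor_lift -big_split.
by apply: eq_bigr => p _; rewrite /= linearDl.
Qed.

Lemma tensor_mapDr U U' V V' (f : {linear U -> U'}) (h h' : {linear V -> V'})
    (t : tensor U V) :
  tensor_map f (h \+ h') t = tensor_map f h t + tensor_map f h' t.
Proof.
rewrite /tensor_map /tensor_lift -big_split.
by apply: eq_bigr => p _; rewrite /= linearDr.
Qed.

(** An [a] applied directly to the first factor of [t] may be traded for a [b]
    on the second.  Both linear conditions on [r] have the form of the
    hypothesis, with [N] and [S] for [a] and [b] in either order. *)
Lemma tensor_map_slide U V U' V' (a : {linear U -> U})
    (b : {linear V -> V}) (f : {linear U -> U'}) (h : {linear V -> V'})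
    (t : tensor U V) :
  tensor_map a idfun t = tensor_map idfun b t ->
  tensor_map (f \o a) h t = tensor_map f (h \o b) t.
Proof.
move=> ab; transitivity (tensor_map f h (tensor_map a idfun t)).
  by rewrite tensor_map_comp; apply: eq_tensor_map.
by rewrite ab tensor_map_comp; apply: eq_tensor_map.
Qed.

Lemma tensor_flip_map U U' V V' (f : {linear U -> U'}) (h : {linear V -> V'})
    (t : tensor U V) :
  tensor_flip (tensor_map f h t) = tensor_map h f (tensor_flip t).
Proof.
apply: (tensor_ext (f := @tensor_flip K U' V' \o tensor_map f h)
  (h := tensor_map h f \o @tensor_flip K U V)) => x y.
by rewrite /= !(tensor_mapE, tensor_flipE).
Qed.

Lemma tensor_cycle_map U U' V V' W W' (f : {linear U -> U'})
    (h : {linear V -> V'}) (k : {linear W -> W'})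
    (t : tensor U (tensor V W)) :
  tensor_cycle (tensor_map f (tensor_map h k) t)
  = tensor_map h (tensor_map k f) (tensor_cycle t).
Proof.
apply: (tensor3_ext
  (f := @tensor_cycle K U' V' W' \o tensor_map f (tensor_map h k))
  (h := tensor_map h (tensor_map k f) \o @tensor_cycle K U V W)) => x y z.
rewrite /reverse_coercion /=.
by rewrite !(tensor_mapE, tensor_cycleE) /= !(tensor_mapE, tensor_cycleE).
Qed.

Lemma tensor_cycleK U (t : tensor U (tensor U U)) :
  tensor_cycle (tensor_cycle (tensor_cycle t)) = t.
Proof.
move: t; apply: (tensor3_ext (f := @tensor_cycle K U U U \o
  (@tensor_cycle K U U U \o @tensor_cycle K U U U)) (h := idfun)) => x y z.
by rewrite /= !tensor_cycleE.
Qed.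

(** Antisymmetry of [r] in the form used inside sums: the two factors of [r]
    may be exchanged, at the cost of a sign, in every expression depending
    bilinearly on them. *)
Lemma antisymmetric_sum U W (F : U -> U -> W) (r : tensor U U) :
  bilinear_for *:%R *:%R F -> tensor_flip r = - r ->
  \sum_(u <- tensor_terms r) F u.1 u.2
  = - \sum_(u <- tensor_terms r) F u.2 u.1.
Proof.
move=> F_bilin rN; pose s := [seq (u.2, u.1) | u <- tensor_terms r].
have rE : r = tensor_class (scale_terms (-1) s).
  rewrite -tensor_classZ scaleN1r tensor_class_sum big_map -[r in LHS]opprK -rN.
  by rewrite /tensor_flip /tensor_lift.
rewrite -/(tensor_lift F r) {1}rE (tensor_lift_class F_bilin) !big_map -sumrN.
apply: eq_bigr => u _ /=.
have /= := F_bilin.1 u.1 (-1) u.2 0; rewrite addr0 => ->.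
have /= := F_bilin.1 u.1 (-1) 0 0; rewrite scaler0 addr0 scaleN1r addNr => ->.
by rewrite addr0 scaleN1r.
Qed.

End TensorMapTheory.

(** * The classical Yang-Baxter equation as a cyclic sum *)

HB.instance Definition _ (K : fieldType) (g : lieAlgType K) :=
  bilinear_isBilinear.Build K g g g *:%R *:%R (@lie_bracket K g)
    (conj (@lie_bracketl_linear K g) (@lie_bracketr_linear K g)).

Section LieAlgebra.
Variables (K : fieldType) (g : lieAlgType K).
Implicit Types (x y z : g) (r : tensor g g).

Lemma lie_bracketC x y : [lie x, y] = - [lie y, x].
Proof.
apply/eqP; rewrite -addr_eq0; apply/eqP.
have := lie_bracketxx (x + y).
by rewrite linearDl !linearDr /= !lie_bracketxx add0r addr0.
Qed.

Lemma ad_lie x y z :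
  ad x [lie y, z] = [lie [lie x, y], z] + [lie y, [lie x, z]].
Proof.
rewrite (lie_bracketC [lie x, y]) (lie_bracketC x z) linearNr /=; apply/eqP.
by rewrite -opprD -addr_eq0 addrCA addrC lie_jacobi.
Qed.

(** The three terms of the Yang-Baxter element, named by the positions of the
    two copies of [r] inside the threefold tensor product. *)
Definition bracket13_23 r : tensor g (tensor g g) :=
  \sum_(u <- tensor_terms r) \sum_(v <- tensor_terms r)
    u.1 \ox (v.1 \ox [lie u.2, v.2]).

Definition bracket12_23 r : tensor g (tensor g g) :=
  \sum_(u <- tensor_terms r) \sum_(v <- tensor_terms r)
    u.1 \ox ([lie u.2, v.1] \ox v.2).

Definition bracket12_13 r : tensor g (tensor g g) :=
  \sum_(u <- tensor_terms r) \sum_(v <- tensor_terms r)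
    [lie u.1, v.1] \ox (u.2 \ox v.2).

(** Rotation turns [[r13, r23]] into [[r32, r12]]; the signs from [r32 = - r23]
    and from reversing the bracket cancel. *)
Lemma cycle_bracket13_23 r : antisymmetric_tensor r ->
  tensor_cycle (bracket13_23 r) = bracket12_23 r.
Proof.
move=> r_anti; rewrite linear_sum /bracket12_23.
under eq_bigr do rewrite linear_sum.
rewrite exchange_big; apply: eq_bigr => v _ /=.
under eq_bigr do rewrite tensor_cycleE.
rewrite (antisymmetric_sum (F := fun a b => v.1 \ox ([lie b, v.2] \ox a))) //.
  rewrite -sumrN; apply: eq_bigr => u _.
  by rewrite (lie_bracketC u.1) linearNl linearNr opprK.
split=> [b s a a'|a s b b'] /=.
  by rewrite !linearPr.
by rewrite !linearPl linearPr.
Qed.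

Lemma cycle_bracket12_23 r : antisymmetric_tensor r ->
  tensor_cycle (bracket12_23 r) = bracket12_13 r.
Proof.
move=> r_anti; rewrite linear_sum /bracket12_13.
under eq_bigr do rewrite linear_sum.
rewrite exchange_big; apply: eq_bigr => v _ /=.
under eq_bigr do rewrite tensor_cycleE.
rewrite (antisymmetric_sum (F := fun a b => [lie b, v.1] \ox (v.2 \ox a))) //.
  rewrite -sumrN; apply: eq_bigr => u _.
  by rewrite (lie_bracketC u.1) linearNl opprK.
split=> [b s a a'|a s b b'] /=.
  by rewrite !linearPr.
by rewrite !linearPl.
Qed.

Lemma yang_baxter_cyclic r : antisymmetric_tensor r ->
  yang_baxter r = bracket13_23 r + tensor_cycle (bracket13_23 r)
    + tensor_cycle (tensor_cycle (bracket13_23 r)).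
Proof.
move=> r_anti; rewrite cycle_bracket13_23 // cycle_bracket12_23 //.
rewrite /yang_baxter; under eq_bigr do rewrite !big_split /=.
by rewrite !big_split /= [RHS]addrC addrA addrAC.
Qed.

End LieAlgebra.

(** * Cyclic sums and the diagonal action *)

Section CyclicSum.
Variables (K : fieldType) (U : lmodType K).
Implicit Types t : tensor U (tensor U U).

Definition cyclic_sum t := t + tensor_cycle t + tensor_cycle (tensor_cycle t).

Lemma cyclic_sumD t t' : cyclic_sum (t + t') = cyclic_sum t + cyclic_sum t'.
Proof. by rewrite /cyclic_sum !linearD /= [RHS]addrACA (addrACA t). Qed.

Lemma cyclic_sumN t : cyclic_sum (- t) = - cyclic_sum t.
Proof. by rewrite /cyclic_sum !linearN /= !opprD. Qed.

Lemma cyclic_sum_cycle t : cyclic_sum (tensor_cycle t) = cyclic_sum t.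
Proof. by rewrite /cyclic_sum tensor_cycleK addrC addrA. Qed.

(** The endomorphism [f] extended to the threefold tensor product by the Leibniz
    rule.  The identity on the last two factors is
    spelled factorwise so that rotation can permute the three of them. *)
Definition diagonal_action (f : {linear U -> U}) t :=
  tensor_map f (tensor_map idfun idfun) t
  + tensor_map idfun (tensor_map f idfun) t
  + tensor_map idfun (tensor_map idfun f) t.

Lemma diagonal_actionD f t t' :
  diagonal_action f (t + t') = diagonal_action f t + diagonal_action f t'.
Proof.
rewrite /diagonal_action !linearD /= [RHS]addrACA.
by rewrite (addrACA _ _ (tensor_map f _ t')).
Qed.

Lemma cycle_diagonal_action f t :
  tensor_cycle (diagonal_action f t) = diagonal_action f (tensor_cycle t).
Proof.
rewrite /diagonal_action !linearD /= !tensor_cycle_map.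
by rewrite [RHS]addrC addrA.
Qed.

Lemma cyclic_sum_diagonal_action f t :
  cyclic_sum (diagonal_action f t) = diagonal_action f (cyclic_sum t).
Proof. by rewrite /cyclic_sum !cycle_diagonal_action !diagonal_actionD. Qed.

End CyclicSum.

(** * The co-Jacobi identity of a coboundary *)

Section CoJacobi.
Variables (K : fieldType) (g : lieAlgType K).
Implicit Types (x y : g) (r : tensor g g).

(** In [(Id \ox delta) r] the argument of [delta] is the second factor of [r],
    so its two terms are literally [[r12, r23]] and [[r13, r23]]. *)
Lemma tensor_map_coboundary r :
  tensor_map idfun (coboundary r) r = bracket13_23 r + bracket12_23 r.
Proof.
rewrite addrC -big_split /tensor_map /tensor_lift; apply: eq_bigr => u _ /=.
by rewrite /coboundary /tensor_map /tensor_lift !linearDr !linear_sumr.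
Qed.

(** The derivation property of [ad x] splits [x._3 [r13, r23]] into two terms.
    One of them occurs in [(Id \ox delta (ad x)) r]; by antisymmetry of [r] the
    other is a rotation of the remaining term [t] there. *)
Lemma tensor_map_coboundary_ad r x : antisymmetric_tensor r ->
  exists t, tensor_map idfun (coboundary r \o ad x) r
    = tensor_map idfun (tensor_map idfun (ad x)) (bracket13_23 r)
      + (t - tensor_cycle (tensor_cycle t)).
Proof.
move=> r_anti.
pose t := \sum_(u <- tensor_terms r) \sum_(v <- tensor_terms r)
  u.1 \ox ([lie [lie x, u.2], v.1] \ox v.2).
pose w := \sum_(u <- tensor_terms r) \sum_(v <- tensor_terms r)
  u.1 \ox (v.1 \ox [lie [lie x, u.2], v.2]).
have deltaE : tensor_map idfun (coboundary r \o ad x) r = t + w.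
  rewrite -big_split /tensor_map /tensor_lift; apply: eq_bigr => u _ /=.
  by rewrite /coboundary /tensor_map /tensor_lift !linearDr !linear_sumr.
have leg3E : tensor_map idfun (tensor_map idfun (ad x)) (bracket13_23 r)
    = w + tensor_cycle (tensor_cycle t).
  have -> : tensor_cycle (tensor_cycle t)
      = \sum_(u <- tensor_terms r) \sum_(v <- tensor_terms r)
          v.1 \ox (u.1 \ox [lie v.2, [lie x, u.2]]).
    have cycle_sum (F : g * g -> tensor g (tensor g g)) :
        tensor_cycle (\sum_(v <- tensor_terms r) F v)
        = \sum_(v <- tensor_terms r) tensor_cycle (F v) by apply: linear_sum.
    rewrite /t !cycle_sum; apply: eq_bigr => u _; rewrite !cycle_sum.
    under eq_bigr do rewrite !tensor_cycleE.
    (* [r_anti] applies to the copy of [r] indexed by [v], with [u] fixed *)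
    rewrite (antisymmetric_sum
      (F := fun a b => b \ox (u.1 \ox [lie [lie x, u.2], a]))) //.
      rewrite -sumrN; apply: eq_bigr => v _.
      by rewrite (lie_bracketC v.2) !linearNr.
    split=> [b s a a'|a s b b'] /=; first by rewrite !linearPr.
    by rewrite !linearPl.
  rewrite exchange_big linear_sum -big_split; apply: eq_bigr => u _ /=.
  rewrite linear_sum -big_split; apply: eq_bigr => v _ /=.
  by rewrite /reverse_coercion !tensor_mapE /= tensor_mapE /= ad_lie !linearDr.
exists t; rewrite deltaE leg3E.
by rewrite addrACA subrr addr0 addrC.
Qed.

Lemma coboundary_cojacobi r x : antisymmetric_tensor r -> yang_baxter r = 0 ->
  cyclic_sum (tensor_map idfun (coboundary r) (coboundary r x)) = 0.
Proof.
move=> r_anti r_cybe; set c := bracket13_23 r.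
have -> : tensor_map idfun (coboundary r) (coboundary r x)
    = tensor_map (ad x) (tensor_map idfun idfun) (c + tensor_cycle c)
      + tensor_map idfun (coboundary r \o ad x) r.
  rewrite /c cycle_bracket13_23 // -tensor_map_coboundary.
  rewrite {2}/coboundary linearD /= !tensor_map_comp; congr (_ + _).
  by apply: eq_tensor_map => // y; rewrite /= tensor_map_id.
have [t ->] := tensor_map_coboundary_ad x r_anti; rewrite -/c.
have leg1E : tensor_map (ad x) (tensor_map idfun idfun) (tensor_cycle c)
    = tensor_cycle (tensor_map idfun (tensor_map (ad x) idfun) c).
  by rewrite tensor_cycle_map.
rewrite linearD /= leg1E !cyclic_sumD cyclic_sumN !cyclic_sum_cycle.
rewrite subrr addr0 -!cyclic_sumD cyclic_sum_diagonal_action.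
rewrite /cyclic_sum -yang_baxter_cyclic // r_cybe.
by rewrite /diagonal_action !linear0 !addr0.
Qed.

End CoJacobi.

(** * Cocycle condition and compatibility with N and S *)

Section Coboundary.
Variables (K : fieldType) (g : lieAlgType K).
Implicit Types (x y : g) (N S : {linear g -> g}) (r : tensor g g).

Lemma coboundary_antisymmetric r x : antisymmetric_tensor r ->
  coboundary r x = - tensor_flip (coboundary r x).
Proof.
move=> r_anti; rewrite /coboundary linearD /= !tensor_flip_map r_anti !linearN.
by rewrite -opprD opprK addrC.
Qed.

(** Actions of [x] and [y] on different factors of [r] commute, so the mixed
    terms cancel and only [[ad x, ad y] = ad [x, y]] remains on each
    factor. *)
Lemma coboundary_cocycle r x y :
  coboundary r [lie x, y]
  = (tensor_map (ad x) idfun (coboundary r y)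
      + tensor_map idfun (ad x) (coboundary r y))
    - (tensor_map (ad y) idfun (coboundary r x)
      + tensor_map idfun (ad y) (coboundary r x)).
Proof.
have adE z : (ad x \o ad y) z = (ad [lie x, y] \+ (ad y \o ad x)) z.
  by rewrite /= ad_lie.
have adEl : tensor_map (ad x \o ad y) idfun r
    = tensor_map (ad [lie x, y]) idfun r + tensor_map (ad y \o ad x) idfun r.
  by rewrite -tensor_mapDl; apply: eq_tensor_map.
have adEr : tensor_map idfun (ad x \o ad y) r
    = tensor_map idfun (ad [lie x, y]) r + tensor_map idfun (ad y \o ad x) r.
  by rewrite -tensor_mapDr; apply: eq_tensor_map.
have actE u v : tensor_map (ad u) idfun (coboundary r v)
      + tensor_map idfun (ad u) (coboundary r v)
    = (tensor_map (ad u \o ad v) idfun r + tensor_map idfun (ad u \o ad v) r)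
      + (tensor_map (ad u) (ad v) r + tensor_map (ad v) (ad u) r).
  rewrite /coboundary !linearD /= !tensor_map_comp.
  rewrite [X in _ + X]addrC addrACA.
  by congr (_ + _ + (_ + _)); apply: eq_tensor_map.
rewrite !actE adEl adEr [X in _ - (_ + X)]addrC opprD addrACA subrr addr0.
by rewrite -/(coboundary r _) addrACA addrK.
Qed.

(** Both factors reduce to the admissibility of [S], with the two arguments of
    the bracket exchanged. *)
Lemma coboundary_coalgebra_compat N S r x :
  admissible N S ->
  tensor_map N idfun r = tensor_map idfun S r ->
  tensor_map S idfun r = tensor_map idfun N r ->
  tensor_map S S (coboundary r x)
  = tensor_map S idfun (coboundary r (S x))
    + tensor_map idfun S (coboundary r (S x)) - coboundary r (S (S x)).
Proof.
move=> S_adm rN rS.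
have adm : (S \o ad x \o N) \+ ad (S (S x))
    =1 (S \o ad (S x)) \+ (ad (S x) \o N).
  move=> p.
  rewrite /= /ad (lie_bracketC x) (lie_bracketC (S (S x))).
  rewrite (lie_bracketC (S x) p) (lie_bracketC (S x) (N p)) !linearN -!opprD /=.
  by rewrite S_adm addrC.
have eSl : tensor_map S S (tensor_map (ad x) idfun r)
    = tensor_map (S \o ad x \o N) idfun r.
  by rewrite (tensor_map_slide _ _ rN) tensor_map_comp; apply: eq_tensor_map.
have eSr : tensor_map S S (tensor_map idfun (ad x) r)
    = tensor_map idfun (S \o ad x \o N) r.
  by rewrite -(tensor_map_slide _ _ rS) tensor_map_comp; apply: eq_tensor_map.
have eSlr : tensor_map S idfun (tensor_map idfun (ad (S x)) r)
    = tensor_map idfun (ad (S x) \o N) r.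
  by rewrite -(tensor_map_slide _ _ rS) tensor_map_comp; apply: eq_tensor_map.
have eSrl : tensor_map idfun S (tensor_map (ad (S x)) idfun r)
    = tensor_map (ad (S x) \o N) idfun r.
  by rewrite (tensor_map_slide _ _ rN) tensor_map_comp; apply: eq_tensor_map.
have eSll : tensor_map S idfun (tensor_map (ad (S x)) idfun r)
    = tensor_map (S \o ad (S x)) idfun r.
  by rewrite tensor_map_comp; apply: eq_tensor_map.
have eSrr : tensor_map idfun S (tensor_map idfun (ad (S x)) r)
    = tensor_map idfun (S \o ad (S x)) r.
  by rewrite tensor_map_comp; apply: eq_tensor_map.
apply: (addIr (coboundary r (S (S x)))); rewrite subrK /coboundary !linearD /=.
rewrite eSl eSr eSlr eSrl eSll eSrr addrACA.
rewrite -tensor_mapDl -tensor_mapDr (eq_tensor_map adm (frefl idfun)).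
rewrite (eq_tensor_map (frefl idfun) adm) tensor_mapDl tensor_mapDr.
by rewrite [X in _ + X]addrC addrACA.
Qed.

(** The first factor reduces to the Nijenhuis identity of [N], the second one to
    the admissibility of [S]. *)
Lemma coboundary_mixed_compat N S r x :
  nijenhuis_lie_algebra N ->
  admissible N S ->
  tensor_map N idfun r = tensor_map idfun S r ->
  tensor_map N S (coboundary r x)
    + (tensor_map N idfun (coboundary r (N x))
       - tensor_map idfun S (coboundary r (N x)))
    - tensor_map (N \o N) idfun (coboundary r x) = 0.
Proof.
move=> N_nij S_adm rN.
have nij : (N \o ad x \o N) \+ (N \o ad (N x))
    =1 (ad (N x) \o N) \+ (N \o N \o ad x).
  by move=> p; rewrite /= /ad N_nij linearB linearD /= subrK addrC.
have adm : (S \o ad x \o S) \+ (ad (N x) \o S)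
    =1 (S \o ad (N x)) \+ (ad x \o S \o S).
  by move=> q; rewrite /= /ad S_adm addrC.
have eNSl : tensor_map N S (tensor_map (ad x) idfun r)
    = tensor_map (N \o ad x \o N) idfun r.
  by rewrite (tensor_map_slide _ _ rN) tensor_map_comp; apply: eq_tensor_map.
have eNSr : tensor_map N S (tensor_map idfun (ad x) r)
    = tensor_map idfun (S \o ad x \o S) r.
  by rewrite -(tensor_map_slide _ _ rN) tensor_map_comp; apply: eq_tensor_map.
have eNl : tensor_map N idfun (tensor_map (ad (N x)) idfun r)
    = tensor_map (N \o ad (N x)) idfun r.
  by rewrite tensor_map_comp; apply: eq_tensor_map.
have eNr : tensor_map N idfun (tensor_map idfun (ad (N x)) r)
    = tensor_map idfun (ad (N x) \o S) r.
  by rewrite -(tensor_map_slide _ _ rN) tensor_map_comp; apply: eq_tensor_map.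
have eSl : tensor_map idfun S (tensor_map (ad (N x)) idfun r)
    = tensor_map (ad (N x) \o N) idfun r.
  by rewrite (tensor_map_slide _ _ rN) tensor_map_comp; apply: eq_tensor_map.
have eSr : tensor_map idfun S (tensor_map idfun (ad (N x)) r)
    = tensor_map idfun (S \o ad (N x)) r.
  by rewrite tensor_map_comp; apply: eq_tensor_map.
have eNNl : tensor_map (N \o N) idfun (tensor_map (ad x) idfun r)
    = tensor_map (N \o N \o ad x) idfun r.
  by rewrite tensor_map_comp; apply: eq_tensor_map.
have eNNr : tensor_map (N \o N) idfun (tensor_map idfun (ad x) r)
    = tensor_map idfun (ad x \o S \o S) r.
  rewrite -2!(tensor_map_slide _ _ rN) tensor_map_comp.
  exact: eq_tensor_map.
rewrite addrA -(addrA _ (- _)) -opprD; apply/eqP; rewrite subr_eq0; apply/eqP.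
rewrite /coboundary !linearD /= eNSl eNSr eNl eNr eSl eSr eNNl eNNr.
rewrite addrACA [RHS]addrACA -!tensor_mapDl -!tensor_mapDr.
by congr (_ + _); apply: eq_tensor_map.
Qed.

End Coboundary.

Theorem proposition6p16 (K : fieldType) (g : lieAlgType K)
    (N S : {linear g -> g}) (r : tensor g g) :
  nijenhuis_lie_algebra N ->
  admissible N S ->
  antisymmetric_tensor r ->
  admissible_yang_baxter N S r ->
  nijenhuis_lie_bialgebra N (coboundary r) S.
Proof.
move=> N_nij S_adm r_anti [r_cybe /subr0_eq rN /subr0_eq rS].
split=> [|x y||x].
- split=> //; split; last by move=> x; apply: coboundary_coalgebra_compat.
  by split=> x; [apply: coboundary_antisymmetric | apply: coboundary_cojacobi].
- exact: coboundary_cocycle.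
- exact: S_adm.
- exact: coboundary_mixed_compat.
Qed.
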